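(* Let $G$ be a finite group, let $A$ be an mt-stabilizer in $G$, and let $K_{G:A}=\bigcap_{g\in G}A^g$ be the core of $A$ in $G$. Suppose $H\neq G$ is a normal subgroup of $G$ with $K_{G:A}\subseteq H$ and $H\neq K_{G:A}$. Then $AH\neq A$ and $AH$ is an mt-stabilizer in $G$.
   Context: For a subgroup $A$ of a finite group $G$, $G:A$ denotes the set of cosets of $A$ in $G$ with the natural transitive action of $G$; its kernel is the core $K_{G:A}=\bigcap_{g\in G}A^g$. The subgroup $A$ is an mt-stabilizer in $G$ (equivalently, $G$ acts minimally transitively on $G:A$) if every subgroup $H$ with $K_{G:A}\subseteq H\subsetneq G$ acts intransitively on $G:A$; that is, whenever a subgroup $H\subseteq G$ is transitive on $G:A$, then $HK_{G:A}=G$. *)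

(* Defs.v *)
From mathcomp Require Import all_boot all_fingroup.

Set Implicit Arguments.
Unset Strict Implicit.
Unset Printing Implicit Defensive.

Local Open Scope group_scope.

(* [rcosets A G] is the set G:A of right cosets A x (x in G), on which G acts
   by right translation ['Rs], and [gcore A G] is \bigcap_(x in G) A :^ x.
   [A] is a mere set, and being a subgroup is part of the definition, so that
   it applies directly to a setwise product such as A * H. *)
Definition mt_stabilizer (gT : finGroupType) (G : {group gT}) (A : {set gT}) : Prop :=
  [/\ group_set A, A \subset G
    & forall H : {group gT}, gcore A G \subset H -> H \proper G ->
        ~~ [transitive H, on rcosets A G | 'Rs]].

(* Main.v *)
Require Import Defs.
From mathcomp Require Import all_boot all_fingroup.

(** A subgroup [L] of [G] is transitive on the cosets of a subgroup [B] exactly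
    when [B * L = G] ([transitive_rcosetsP]).  So if [L] contains the core of
    [A * H] and is transitive on the cosets of [A * H], then [A * H * L = G].
    Being normal in [G] and contained in [A * H], the group [H] lies in that
    core, hence in [L], and is absorbed: [A * L = G].  Thus [L] is transitive
    on the cosets of [A] too, and it contains the core of [A] because [H] does;
    minimal transitivity of [G] on the cosets of [A] forbids [L] to be proper.
    Finally, [A * H = A] would put the normal subgroup [H] inside [A], hence
    inside the core of [A], which [H] contains strictly. *)

Local Open Scope group_scope.

(** The coset [B] has stabiliser [B] in the transitive action of [G], and a
    subgroup of a transitive group is itself transitive exactly when its product
    with a point stabiliser is the whole group. *)
Lemma transitive_rcosetsP (gT : finGroupType) (G B L : {group gT}) :
    B \subset G -> L \subset G ->
  reflect (B * L = G) [transitive L, on rcosets B G | 'Rs].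
Proof.
move=> sBG sLG; have BG_B : (B : {set gT}) \in rcosets B G.
  by apply/rcosetsP; exists 1; rewrite ?group1 ?mulg1.
have := subgroup_transitiveP BG_B sLG (transRs_rcosets B G).
by rewrite astab1Rs (setIidPr sBG).
Qed.

Theorem theorem2p3 (gT : finGroupType) (G A H : {group gT})
    (mtA : mt_stabilizer G A) (neqHG : H <> G) (nHG : H <| G)
    (sKH : gcore A G \subset H) (neqHK : H <> gcore A G :> {set gT}) :
  A * H <> A /\ mt_stabilizer G (A * H).
Proof.
case: mtA => _ sAG minA; have [sHG nHsG] := andP nHG.
split=> [AH_A|].
  have sHA : H \subset A by rewrite -AH_A mulG_subr.
  by apply: neqHK; apply/eqP; rewrite eqEsubset sKH sub_gcore ?sHA.
have defAH : A <*> H = A * H by rewrite norm_joinEl ?(subset_trans sAG).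
have sAHG : A <*> H \subset G by rewrite join_subG sAG.
rewrite -defAH; split=> [||L sKL prL]; [exact: groupP | by [] |].
have sLG := proper_sub prL.
have sHL : H \subset L.
  by apply: subset_trans sKL; rewrite sub_gcore ?joing_subr.
apply: contra (minA L (subset_trans sKH sHL) prL) => trL.
apply/transitive_rcosetsP=> //.
by rewrite -[in LHS](mulSGid sHL) mulgA -defAH; apply/transitive_rcosetsP.
Qed.
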